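(* Let $k$ be a positive integer and let $a\in\mathbb{C}$ be a constant. For each $f\in L^2(\mathbb{C},e^{-|z|^2})$, there exists a weak solution $u\in L^2(\mathbb{C},e^{-|z|^2})$ of the equation $$\overline{\partial}^k u+au=f \quad\text{in } \mathbb{C}$$ satisfying the norm estimate $$\int_{\mathbb{C}} |u|^2e^{-|z|^2}\,d\sigma\leq \frac{1}{k!}\int_{\mathbb{C}} |f|^2e^{-|z|^2}\,d\sigma.$$
   Context: $d\sigma=\frac{1}{2i}d\overline{z}\wedge dz$ is the area (Lebesgue) measure on $\mathbb{C}$. $\frac{\partial}{\partial\overline z}=\frac12\left(\frac{\partial}{\partial x}+i\frac{\partial}{\partial y}\right)$ and $\overline{\partial}^k=\frac{\partial^k}{\partial\overline{z}^k}$. $L^2(\mathbb{C},e^{-|z|^2})$ is the Hilbert space of complex-valued $f\in L^2_{loc}(\mathbb{C})$ with $\int_{\mathbb{C}}|f|^2e^{-|z|^2}d\sigma<+\infty$. For $u,g\in L^2_{loc}(\mathbb{C})$, $\overline{\partial}^k u=g$ holds in the weak sense if $\int_{\mathbb{C}}u\,\overline{\partial}^k\phi\, d\sigma=(-1)^k\int_{\mathbb{C}}g\phi\, d\sigma$ for all $\phi\in C_0^\infty(\mathbb{C})$ (smooth compactly supported complex-valued functions). A weak solution of $\overline{\partial}^k u+au=f$ is a $u$ such that $\overline{\partial}^k u=f-au$ in the weak sense. *)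

(* Defs.v *)
From HB Require Import structures.
From mathcomp Require Import all_boot all_order all_algebra.
From mathcomp Require Import all_classical all_reals all_analysis.
From mathcomp Require Export complex.
Set Implicit Arguments.
Unset Strict Implicit.
Unset Printing Implicit Defensive.
Import Order.TTheory GRing.Theory Num.Theory.
Import numFieldNormedType.Exports.
Local Open Scope classical_set_scope.
Local Open Scope ring_scope.
Local Open Scope complex_scope.

Section ComplexPlane.
Variable R : realType.
Implicit Types (f g u phi : R[i] -> R[i]) (z : R[i]).

(* R[i] carries neither a topology nor a sigma-algebra; both are those of
   R * R, transported along (x, y) |-> x + i y. *)
Definition cplx (p : R * R) : R[i] := p.1 +i* p.2.

Definition cabs z : R := ComplexField.Normc.normc z.

(* dsigma = (1 / 2i) d(conj z) /\ dz = dx /\ dy *)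
Local Notation sigma := (@lebesgue_measure R \x @lebesgue_measure R)%E.

Definition Cmeasurable f : Prop :=
  measurable_fun [set: R * R] (fun p : R * R => complex.Re (f (cplx p))) /\
  measurable_fun [set: R * R] (fun p : R * R => complex.Im (f (cplx p))).

Definition Cint f : R[i] :=
  Rintegral sigma [set: R * R] (fun p => complex.Re (f (cplx p))) +i*
  Rintegral sigma [set: R * R] (fun p => complex.Im (f (cplx p))).

Definition L2loc f : Prop :=
  Cmeasurable f /\
  forall K : set (R * R), compact K ->
    (\int[sigma]_(p in K) (cabs (f (cplx p)) ^+ 2)%:E < +oo)%E.

Definition gauss_sqnorm f : \bar R :=
  (\int[sigma]_(p in [set: R * R])
     (cabs (f (cplx p)) ^+ 2 * expR (- cabs (cplx p) ^+ 2))%:E)%E.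

Definition L2gauss f : Prop := L2loc f /\ (gauss_sqnorm f < +oo)%E.

(* Restrictions of a function to the horizontal and vertical lines through z *)
Definition hline f z : R -> R[i] := fun t => f (t +i* complex.Im z).
Definition vline f z : R -> R[i] := fun t => f (complex.Re z +i* t).

Definition Cderivable (h : R -> R[i]) (t : R) : Prop :=
  derivable (fun s => complex.Re (h s)) t 1 /\ derivable (fun s => complex.Im (h s)) t 1.

Definition Cderive (h : R -> R[i]) (t : R) : R[i] :=
  derive1 (fun s => complex.Re (h s)) t +i* derive1 (fun s => complex.Im (h s)) t.

Definition partial_x f : R[i] -> R[i] := fun z => Cderive (hline f z) (complex.Re z).
Definition partial_y f : R[i] -> R[i] := fun z => Cderive (vline f z) (complex.Im z).

Definition dbar f : R[i] -> R[i] :=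
  fun z => 2^-1 * (partial_x f z + (0 +i* 1) * partial_y f z).

Definition Ccontinuous f : Prop :=
  continuous (fun p : R * R => complex.Re (f (cplx p))) /\
  continuous (fun p : R * R => complex.Im (f (cplx p))).

(* Real differentiability class C^n on the plane *)
Fixpoint class_C (n : nat) f : Prop :=
  if n is m.+1 then
    [/\ Ccontinuous f,
        forall z, Cderivable (hline f z) (complex.Re z) /\
                  Cderivable (vline f z) (complex.Im z),
        class_C m (partial_x f) & class_C m (partial_y f)]
  else Ccontinuous f.

Definition test_function phi : Prop :=
  (forall n, class_C n phi) /\
  compact (closure [set p : R * R | phi (cplx p) != 0]).

Definition weak_dbar (k : nat) u g : Prop :=
  [/\ L2loc u, L2loc g &
      forall phi, test_function phi ->
        Cint (fun z => u z * iter k dbar phi z) =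
        (-1) ^+ k * Cint (fun z => g z * phi z)].

Definition weak_solution (k : nat) (a : R[i]) f u : Prop :=
  weak_dbar k u (fun z => f z - a * u z).

End ComplexPlane.

(* Main.v *)
Require Import Defs.
From HB Require Import structures.
From mathcomp Require Import all_boot all_order all_algebra.
From mathcomp Require Import all_classical all_reals all_analysis.
From mathcomp Require Import ssrAC measurable_realfun ring lra.
Set Implicit Arguments.
Unset Strict Implicit.
Unset Printing Implicit Defensive.
Import Order.TTheory GRing.Theory Num.Theory.
Import numFieldNormedType.Exports.
Local Open Scope classical_set_scope.
Local Open Scope ring_scope.

(** This is Hoermander's L2 method, in a case where the a priori estimate comes
    from the canonical commutation relation alone.

    Let [D] be the dbar operator on test functions [P], with the scalar product
    [<P, Q> = Re \int P conj(Q) exp(|z|^2)] (the weight is the inverse of the one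
    in the theorem, because test functions are dual to the unknown).  One
    integration by parts gives the adjoint [E = - del - conj z] of [D], and then
    [E D = D E + 1] ([tpartial_adj], [cdbar_adjoint], [cdbar_ccr]); this needs the
    symmetry of second derivatives ([partial_comm]).  From the relation alone,
    by induction on [k],
      [|D^k P|^2 >= |E^k P|^2 + k! |P|^2]   ([ccr_energy]).
    Adding a constant [b] to [D^k] and its conjugate to [E^k] changes both squared
    norms by the same amount, since multiplication by [b] commutes with everything
    and is normal.  As [|E^k P + conj(b) P|^2 >= 0], it follows that
      [|D^k P + b P|^2 >= k! |P|^2]   ([ccr_perturbed_energy], [tdbar_energy])
    whatever [b] is; this is why the constant [a] does not enter the bound.

    With [b = (-1)^k a], a weak solution [u] is a function whose pairing with
    [D^k P + b P] is [(-1)^k \int f P] for every [P].  By Cauchy-Schwarz and the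
    estimate, this prescribed value is bounded by
      [|f| |P| <= (k!)^(-1/2) |f| |D^k P + b P|],
    so that Riesz representation produces [u] with the announced norm
    ([riesz_range], [solve_dual]).  The representing vector is the limit of a
    minimizing sequence of [|T P|^2 - 2 l(P)], [T P = D^k P + b P]; it exists
    because L2 is complete ([L2_complete]).

    Everything is done over the reals: a complex function is the pair of its
    components, only real parts of pairings are computed, and the imaginary part
    of a pairing is the real part of the pairing with [-i P].  Functions in
    [L2(exp(-|z|^2))] are written [exp(|z|^2 / 2) v] with [v] in the unweighted
    L2 space. *)

(** * Positive semidefinite forms *)

Section SemiInner.
Context {R : realType}.

(** Only semidefinite: in L2 a vector of norm zero is a function that vanishes
    almost everywhere, and no quotient is taken. *)
Record semi_inner (V : lmodType R) (B : V -> V -> R) : Prop := SemiInner {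
  siC : forall u v, B u v = B v u;
  siDl : forall u v w, B (u + v) w = B u w + B v w;
  siZl : forall c u w, B (c *: u) w = c * B u w;
  si_ge0 : forall u, 0 <= B u u }.

Section Theory.
Variables (V : lmodType R) (B : V -> V -> R) (hB : semi_inner B).

Lemma siDr u v w : B w (u + v) = B w u + B w v.
Proof. by rewrite !(siC hB w) siDl. Qed.

Lemma siZr c u w : B w (c *: u) = c * B w u.
Proof. by rewrite !(siC hB w) siZl. Qed.

Lemma siNl u w : B (- u) w = - B u w.
Proof. by rewrite -scaleN1r siZl// mulN1r. Qed.

Lemma siNr u w : B w (- u) = - B w u.
Proof. by rewrite !(siC hB w) siNl. Qed.

Lemma siBl u v w : B (u - v) w = B u w - B v w.
Proof. by rewrite siDl// siNl. Qed.

Lemma siBr u v w : B w (u - v) = B w u - B w v.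
Proof. by rewrite siDr siNr. Qed.

Lemma si_sqrD u v : B (u + v) (u + v) = B u u + 2 * B u v + B v v.
Proof. by rewrite siDl// !siDr (siC hB v u); ring. Qed.

Lemma si_sqrB u v : B (u - v) (u - v) = B u u - 2 * B u v + B v v.
Proof. by rewrite siBl !siBr (siC hB v u); ring. Qed.

Lemma nonneg_quadratic_discr (a b c : R) : 0 <= c ->
  (forall t, 0 <= a + 2 * t * b + t ^+ 2 * c) -> b ^+ 2 <= a * c.
Proof.
rewrite le_eqVlt => /predU1P[<- h|c0 h].
  rewrite mulr0; have [->|b0] := eqVneq b 0; first by rewrite expr0n.
  exfalso; have := h (- (a + 1) / (2 * b)).
  have -> : a + 2 * (- (a + 1) / (2 * b)) * b + (- (a + 1) / (2 * b)) ^+ 2 * 0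
            = - 1 by field; rewrite b0.
  lra.
have := h (- b / c).
have -> : a + 2 * (- b / c) * b + (- b / c) ^+ 2 * c = (a * c - b ^+ 2) / c.
  by field; rewrite gt_eqF.
by rewrite pmulr_lge0 ?invr_gt0// subr_ge0.
Qed.

Lemma le0_of_geometric (x c : R) : (forall n, x <= 4^-1 ^+ n * c) -> x <= 0.
Proof.
move=> h; rewrite leNgt; apply/negP => x0.
have [n] : exists n : nat, c / x < n%:R.
  by exists (Num.truncn `|c / x|).+1; apply: le_lt_trans (ler_norm _) (truncnS_gt _).
rewrite ltr_pdivrMr// => cn; have := h n.
rewrite exprVn mulrC ler_pdivlMr ?exprn_gt0// leNgt => /negP; apply.
apply: lt_le_trans cn _; rewrite mulrC ler_pM2l// -natrX ler_nat ltnW//.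
exact: ltn_expl.
Qed.

Lemma si_CauchySchwarz u v : B u v ^+ 2 <= B u u * B v v.
Proof.
apply: nonneg_quadratic_discr => [|t]; first exact: si_ge0.
have := si_ge0 hB (u + t *: v).
rewrite si_sqrD (siZl hB) !siZr; set x := B u v; set y := B v v.
have -> // : B u u + 2 * (t * x) + t * (t * y) = B u u + 2 * t * x + t ^+ 2 * y.
by ring.
Qed.

End Theory.

(** * The lower bound from the canonical commutation relation *)

Section CCR.
Variables (V : lmodType R) (B : V -> V -> R) (hB : semi_inner B).
Variables (D E : {linear V -> V}).
Hypothesis adjDE : forall p q, B (D p) q = B p (E q).
Hypothesis ccr : forall p, E (D p) = D (E p) + p.

Lemma ccr_iter k p : E (iter k.+1 D p) = iter k.+1 D (E p) + k.+1%:R *: iter k D p.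
Proof.
elim: k => [|k IH]; first by rewrite /= ccr scale1r.
rewrite [iter k.+2 D p]/= ccr [E _]IH linearD linearZ /= -/(iter k.+1 D _).
by rewrite -addrA -[X in _ + (_ + X)]scale1r -scalerDl natr1.
Qed.

(** Moving one [D] to the right turns the product for [k] into a square plus [k]
    times the product for [k - 1]. *)
Lemma ccr_cross_ge0 k p : 0 <= B (iter k.+1 D (E p)) (iter k D p).
Proof.
elim: k p => [|k IH] p; first by rewrite /= adjDE si_ge0.
rewrite iterS adjDE ccr_iter (siDr hB) (siZr hB) addr_ge0 ?si_ge0//.
by rewrite mulr_ge0.
Qed.

Lemma iter_adj k p q : B (iter k D p) q = B p (iter k E q).
Proof. by elim: k q => //= k IH q; rewrite adjDE IH -iterSr. Qed.

(** The norm of [D^(k+1) p] is expanded by [E D = D E + 1] as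
    [|E D^k p|^2 + |D^k p|^2], where [E D^k p = D^k E p + k D^(k-1) p]; the cross
    term is nonnegative, and the three squares are bounded below by induction,
    applied to [E p] for the first and to [p] for the two others.  The factorials
    add up because [k^2 (k-1)! + k! = (k+1)!]. *)
Lemma ccr_energy k p :
  B (iter k.+1 E p) (iter k.+1 E p) + (k.+1)`!%:R * B p p
  <= B (iter k.+1 D p) (iter k.+1 D p).
Proof.
have rec j q : B (iter j.+1 D q) (iter j.+1 D q) =
    B (E (iter j D q)) (E (iter j D q)) + B (iter j D q) (iter j D q).
  by rewrite iterS adjDE ccr (siDr hB) -adjDE (siC hB) adjDE.
(* the induction needs the bound on [|D^k p|^2] as well, one step behind *)
suff [] : B (iter k.+1 E p) (iter k.+1 E p) + (k.+1)`!%:R * B p p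
    <= B (iter k.+1 D p) (iter k.+1 D p)
    /\ k`!%:R * B p p <= B (iter k D p) (iter k D p) by [].
elim: k p => [|k IH] p; first by rewrite rec /= mul1r.
have [IH1 h3] := IH p.
have h2 : (k.+1)`!%:R * B p p <= B (iter k.+1 D p) (iter k.+1 D p).
  by apply: le_trans IH1; rewrite lerDr si_ge0.
split=> //; rewrite rec ccr_iter (si_sqrD hB) !(siZr hB, siZl hB).
have c0 : 0 <= k.+1%:R * B (iter k.+1 D (E p)) (iter k D p).
  by rewrite mulr_ge0// ccr_cross_ge0.
have [h1 _] := IH (E p); rewrite -iterSr in h1.
have h4 : 0 <= (k.+1)`!%:R * B (E p) (E p) by rewrite mulr_ge0 ?si_ge0.
have h5 := ler_wpM2l (mulr_ge0 (ler0n R k.+1) (ler0n R k.+1)) h3.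
have -> : (k.+2)`!%:R = k.+1%:R * k.+1%:R * k`!%:R + (k.+1)`!%:R :> R.
  by rewrite !factS !natrM -(natr1 k.+1); ring.
lra.
Qed.

(** A normal perturbation [M] with adjoint [N] is invisible in the commutator: the
    cross terms [<D^k p, M p>] and [<E^k p, N p>] agree since [N] commutes with
    [D], so replacing [D^k, E^k] by [D^k + M, E^k + N] leaves the difference of
    the squared norms unchanged, and [|E^k p + N p|^2 >= 0]. *)
Lemma ccr_perturbed_energy (M N : {linear V -> V}) k p :
  (forall p q, B (M p) q = B p (N q)) ->
  (forall p, B (M p) (M p) = B (N p) (N p)) ->
  (forall p, D (N p) = N (D p)) ->
  (k.+1)`!%:R * B p p
  <= B (iter k.+1 D p + M p) (iter k.+1 D p + M p).
Proof.
move=> adjMN normMN commDN.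
have commN j q : iter j D (N q) = N (iter j D q).
  by elim: j => // j IH; rewrite !iterS IH commDN.
have cross : B (iter k.+1 D p) (M p) = B (iter k.+1 E p) (N p).
  by rewrite (siC hB) adjMN -commN (siC hB) iter_adj (siC hB).
have := si_ge0 hB (iter k.+1 E p + N p); have := ccr_energy k p.
rewrite !(si_sqrD hB) cross normMN; lra.
Qed.

End CCR.

(** * Riesz representation on the range of an operator *)

Section Riesz.
Variables (V W : lmodType R) (B : W -> W -> R) (hB : semi_inner B).

(** Completeness for sequences that are Cauchy at a geometric rate: a minimizing
    sequence can be chosen so, and the limit is then found without passing to a
    subsequence. *)
Definition fast_complete := forall w : nat -> W,
  (forall n m, (n <= m)%N -> B (w m - w n) (w m - w n) <= 4^-1 ^+ n) ->
  exists v K, forall n, B (v - w n) (v - w n) <= 4^-1 ^+ n * K.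

(** The functional [T p |-> l p] is represented without first extending it to the
    closure of the range: along a minimizing sequence [s] of
    [J p = |T p|^2 - 2 l p], the vectors [T (s n)] are Cauchy by the parallelogram
    identity, and the first variation of [J] at [s n] tends to [0], so their limit
    [v] satisfies [B v (T p) = l p]. *)
Lemma riesz_range (T : {linear V -> W}) (l : V -> R) (C : R) :
  fast_complete -> 0 <= C ->
  (forall p q, l (p + q) = l p + l q) -> (forall c p, l (c *: p) = c * l p) ->
  (forall p, l p ^+ 2 <= C * B (T p) (T p)) ->
  exists v, B v v <= C /\ forall p, B v (T p) = l p.
Proof.
move=> complete C0 lD lZ lC.
(* arithmetic-geometric mean: 2 |l p| <= 2 sqrt (C |T p|^2) *)
have two_l p : 2 * l p <= C + B (T p) (T p).
  have := lC p; have := si_ge0 hB (T p).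
  set b := B _ _ => b0 lb; have := sqr_ge0 (C - b).
  have [l0|l0] := leP (l p) 0; first by lra.
  move=> h; rewrite leNgt; apply/negP => lt.
  have : (C + b) ^+ 2 < (2 * l p) ^+ 2 by rewrite ltr_pXn2r// nnegrE; lra.
  lra.
pose J p := B (T p) (T p) - 2 * l p.
have J_lb p : - C <= J p by have := two_l p; rewrite /J; lra.
have Jinf : has_inf (range J).
  split; first by exists (J 0), 0.
  by exists (- C) => _ [p _ <-].
pose m := inf (range J).
have mJ p : m <= J p by apply: ge_inf; [case: Jinf|exists p].
have e_gt0 n : 0 < 4^-1 ^+ n / 4 :> R by rewrite divr_gt0 ?exprn_gt0.
have /choice[s sP] n : exists p, J p < m + 4^-1 ^+ n / 4.
  by have [_ [p _ <-] ?] := inf_adherent (e_gt0 n) Jinf; exists p.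
have Jline p q t : J (p + t *: q) =
    J p + 2 * t * (B (T p) (T q) - l q) + t ^+ 2 * B (T q) (T q).
  rewrite /J lD lZ linearD linearZ/= (si_sqrD hB) !(siZl hB, siZr hB).
  by ring.
have near_crit n q : (B (T (s n)) (T q) - l q) ^+ 2
    <= 4^-1 ^+ n / 4 * B (T q) (T q).
  apply: nonneg_quadratic_discr => [|t]; first exact: si_ge0.
  by have := mJ (s n + t *: q); rewrite Jline; have := sP n; lra.
have [n k nk|v [K vP]] := complete (T \o s).
  (* parallelogram identity: J is at least m at the midpoint of s n and s k *)
  have := mJ (s n + 2^-1 *: (s k - s n)).
  rewrite Jline lD -scaleN1r lZ scaleN1r linearB/= (siBr hB) (si_sqrB hB).
  move=> h.
  have := sP n; have := sP k; rewrite /J /=.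
  have : 4^-1 ^+ k <= 4^-1 ^+ n :> R by rewrite ler_wiXn2l//; lra.
  move: h; rewrite (siC hB (T (s k)) (T (s n))) /J.
  lra.
have vl p : B v (T p) = l p.
  apply/eqP; rewrite -subr_eq0 -sqrf_eq0 eq_le sqr_ge0 andbT.
  apply: (@le0_of_geometric _ ((2 * K + 2^-1) * B (T p) (T p))) => n.
  have h1 := near_crit n p; have h2 := si_CauchySchwarz hB (v - T (s n)) (T p).
  have h3 := ler_wpM2r (si_ge0 hB (T p)) (vP n).
  rewrite (siBl hB) in h2; rewrite /= in h3.
  move: h1 h2 h3; set x := B v _; set y := B (T (s n)) _; set b := B (T p) _.
  set e := 4^-1 ^+ n; set c := B (v - _) _ => h1 h2 h3.
  have := sqr_ge0 ((x - y) - (y - l p)); lra.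
exists v; split=> //; rewrite -subr_le0.
(* |v|^2 - 2 l (s n) + |T (s n)|^2 = |v - T (s n)|^2 is small, and [two_l] bounds l *)
apply: (@le0_of_geometric _ K) => n.
have := vP n; rewrite (si_sqrB hB) /= vl; have := two_l (s n); lra.
Qed.

End Riesz.
End SemiInner.

(** * Pairs as complexified vectors *)

Section PairForm.
Context {R : realType}.

Definition pair_form (V : Type) (B : V -> V -> R) (p q : V * V) : R :=
  B p.1 q.1 + B p.2 q.2.

Lemma pair_semi_inner (V : lmodType R) (B : V -> V -> R) :
  semi_inner B -> semi_inner (pair_form B).
Proof.
move=> hB; split=> [u v|u v w|c u w|u]; rewrite /pair_form.
- by congr (_ + _); exact: (siC hB).
- by rewrite !(siDl hB) addrACA.
- by rewrite !(siZl hB) mulrDr.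
- by apply: addr_ge0; exact: (si_ge0 hB).
Qed.

Lemma comp_semi_inner (V W : lmodType R) (B : W -> W -> R) (T : {linear V -> W}) :
  semi_inner B -> semi_inner (fun u v => B (T u) (T v)).
Proof.
move=> hB; split=> [u v|u v w|c u w|u]; rewrite ?(linearD, linearZ).
- exact: (siC hB).
- exact: (siDl hB).
- exact: (siZl hB).
- exact: (si_ge0 hB).
Qed.

Lemma pair_fast_complete (V : lmodType R) (B : V -> V -> R) :
  semi_inner B -> fast_complete B -> fast_complete (pair_form B).
Proof.
move=> hB cB w hw.
have [n m nm|v1 [K1 h1]] := cB (fun n => (w n).1).
  apply: le_trans (hw n m nm); have h := si_ge0 hB (w m - w n).2.
  exact: (ler_wpDr h (lexx _)).
have [n m nm|v2 [K2 h2]] := cB (fun n => (w n).2).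
  apply: le_trans (hw n m nm); have h := si_ge0 hB (w m - w n).1.
  exact: (ler_wpDl h (lexx _)).
exists (v1, v2), (K1 + K2) => n; rewrite mulrDr; exact: lerD (h1 n) (h2 n).
Qed.

End PairForm.

Section Complexification.
Context {R : realType} {V : lmodType R}.

(** [(p, q)] stands for [p + i q]: multiplication by [a + i b] on [V + i V]. *)
Definition cmul (a b : R) (p : V * V) : V * V :=
  (a *: p.1 - b *: p.2, a *: p.2 + b *: p.1).

Lemma cmul_is_linear a b : linear (cmul a b).
Proof.
move=> c p q; congr pair => /=.
  by rewrite !scalerDr opprD addrACA scalerN !scalerA (mulrC a) (mulrC b).
by rewrite !scalerDr addrACA !scalerA (mulrC a) (mulrC b).
Qed.
HB.instance Definition _ a b :=
  GRing.isLinear.Build R (V * V)%type (V * V)%type _ (cmul a b) (cmul_is_linear a b).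

Variables (X Y : {linear V -> V}).

(** With [X = d/dx] and [Y = d/dy] this is [(X + i Y) / 2], and [cdel] is
    [(X - i Y) / 2]. *)
Definition cdbar (p : V * V) : V * V :=
  (2^-1 *: (X p.1 - Y p.2), 2^-1 *: (X p.2 + Y p.1)).

Lemma cdbar_is_linear : linear cdbar.
Proof.
move=> c p q; congr pair => /=; rewrite !(linearP X, linearP Y).
  by rewrite opprD addrACA -scalerBr (scalerDr 2^-1) !scalerA (mulrC _ c).
by rewrite addrACA -scalerDr (scalerDr 2^-1) !scalerA (mulrC _ c).
Qed.
HB.instance Definition _ :=
  GRing.isLinear.Build R (V * V)%type (V * V)%type _ cdbar cdbar_is_linear.

Definition cdel (p : V * V) : V * V :=
  (2^-1 *: (X p.1 + Y p.2), 2^-1 *: (X p.2 - Y p.1)).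

Lemma cdel_is_linear : linear cdel.
Proof.
move=> c p q; congr pair => /=; rewrite !(linearP X, linearP Y).
  by rewrite addrACA -scalerDr (scalerDr 2^-1) !scalerA (mulrC _ c).
by rewrite opprD addrACA -scalerBr (scalerDr 2^-1) !scalerA (mulrC _ c).
Qed.
HB.instance Definition _ :=
  GRing.isLinear.Build R (V * V)%type (V * V)%type _ cdel cdel_is_linear.

Lemma cdbar_cmul a b p : cdbar (cmul a b p) = cmul a b (cdbar p).
Proof.
congr pair => /=; rewrite !scalerA (mulrC a) (mulrC b) -!scalerA.
  rewrite -scalerBr (linearB X) (linearD Y) !linearZ/=; congr (_ *: _).
  by rewrite !(opprD, scalerDr, scalerN) addrACA.
rewrite -scalerDr (linearD X) (linearB Y) !linearZ/=; congr (_ *: _).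
by rewrite !(opprD, scalerDr, scalerN) addrACA.
Qed.

End Complexification.

Section ComplexAdjoint.
Context {R : realType} {V : lmodType R} (B : V -> V -> R).
Variables (hB : semi_inner B) (X Y X' Y' : {linear V -> V}).

Lemma cmul_adjoint a b p q :
  pair_form B (cmul a b p) q = pair_form B p (cmul a (- b) q).
Proof.
rewrite /pair_form /= !(siDl hB, siDr hB, siNl hB, siNr hB, siZl hB, siZr hB).
ring.
Qed.

Lemma cmul_norm a b p :
  pair_form B (cmul a b p) (cmul a b p)
  = pair_form B (cmul a (- b) p) (cmul a (- b) p).
Proof.
rewrite /pair_form /= !(siDl hB, siDr hB, siNl hB, siNr hB, siZl hB, siZr hB).
rewrite (siC hB p.2 p.1); ring.
Qed.

Hypotheses (adjX : forall p q, B (X p) q = B p (X' q))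
           (adjY : forall p q, B (Y p) q = B p (Y' q)).

Lemma cdbar_adjoint p q :
  pair_form B (cdbar X Y p) q = pair_form B p (cdel X' Y' q).
Proof.
rewrite /pair_form /= !(siDl hB, siDr hB, siNl hB, siNr hB, siZl hB, siZr hB).
by rewrite !(adjX, adjY); ring.
Qed.

Hypotheses (ccrX : forall p, X' (X p) = X (X' p) + 2 *: p)
           (ccrY : forall p, Y' (Y p) = Y (Y' p) + 2 *: p)
           (commXY : forall p, X' (Y p) = Y (X' p))
           (commYX : forall p, Y' (X p) = X (Y' p)).

(** Both coordinates contribute [2] to the commutator, the factor [1/2] of [cdbar]
    and that of [cdel] contribute [1/4]; the mixed terms cancel. *)
Lemma cdbar_ccr p : cdel X' Y' (cdbar X Y p) = cdbar X Y (cdel X' Y' p) + p.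
Proof.
have split4 (v : V) : v = 2^-1 *: (2^-1 *: (2 *: v + 2 *: v)).
  by rewrite -scalerDl !scalerA -[LHS]scale1r; congr (_ *: _); field.
case: p => p q; congr pair => /=; rewrite !linearZ/= -?(scalerBr, scalerDr).
  rewrite [X in _ = _ + X]split4 -2!scalerDr; congr (_ *: (_ *: _)).
  rewrite !(linearB, linearD)/= ccrX ccrY commXY commYX !(opprD, opprK) !addrA.
  by rewrite [LHS](ACl (1*4*3*5*2*6)).
rewrite [X in _ = _ + X]split4 -2!scalerDr; congr (_ *: (_ *: _)).
rewrite !(linearB, linearD)/= ccrX ccrY commXY commYX !(opprD, opprK) !addrA.
by rewrite [LHS](ACl (1*4*3*5*2*6)).
Qed.

End ComplexAdjoint.

Section ConjLift.
Context {R : realType} {V W : lmodType R} (e : {linear V -> W}).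

(** The conjugate of [e P]: it makes [pair_form B v (conj_lift P)] the real part
    of a pairing that is bilinear over the complex numbers. *)
Definition conj_lift (P : V * V) : W * W := (e P.1, - e P.2).

Lemma conj_lift_is_linear : linear conj_lift.
Proof.
move=> c P Q; congr pair => /=; first exact: linearP.
by rewrite linearP opprD scalerN.
Qed.
HB.instance Definition _ :=
  GRing.isLinear.Build R (V * V)%type (W * W)%type _ conj_lift conj_lift_is_linear.

Variables (B : W -> W -> R) (hB : semi_inner B).

Lemma conj_lift_form P Q :
  pair_form B (conj_lift P) (conj_lift Q) = pair_form (fun u v => B (e u) (e v)) P Q.
Proof. by rewrite /pair_form /= (siNl hB) (siNr hB) opprK. Qed.

Lemma conj_lift_cmul a b v P :
  pair_form B (cmul a b v) (conj_lift P) = pair_form B v (conj_lift (cmul a b P)).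
Proof.
rewrite /pair_form /= (linearB e) (linearD e) !linearZ /=.
by rewrite !(siDl hB, siDr hB, siNl hB, siNr hB, siZl hB, siZr hB); ring.
Qed.

End ConjLift.

(** * Completeness of the space of square integrable functions *)

Section SquareIntegrable.
Context d (T : measurableType d) (R : realType).
Variable mu : {measure set T -> \bar R}.

Lemma L2_exponent : (1 <= 2%:E :> \bar R)%E.
Proof. by rewrite lee_fin; lra. Qed.

Definition L2 := LfunType mu L2_exponent.

Definition ip (f g : T -> R) : R := \int[mu]_x (f x * g x).

Lemma L2_measurable (f : L2) : measurable_fun setT f.
Proof. by have := LfunP f; rewrite inE => /andP[/[!inE]]. Qed.

Lemma L2_intro (h : T -> R) : measurable_fun setT h ->
  (\int[mu]_x (h x ^+ 2)%:E < +oo)%E -> {f : L2 | f =1 h}.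
Proof.
move=> mh hoo; suff Lh : h \in Lfun mu 2%:E by exists (Lfun_Sub L2_exponent Lh).
rewrite inE; apply/andP; split; rewrite inE//=.
rewrite /finite_norm unlock /Lnorm poweR_lty//.
under eq_integral do rewrite /= powR_mulrn// real_normK ?num_real//.
exact: hoo.
Qed.

Lemma integrable_L2M (f g : L2) : mu.-integrable setT (EFin \o (fun x => f x * g x)).
Proof. by apply/Lfun1_integrable/Lfun2_mul_Lfun1; exact: LfunP. Qed.

Lemma L2_addE (f g : L2) : (f + g : L2) =1 (fun x => f x + g x).
Proof. by []. Qed.

Lemma L2_scaleE (c : R) (f : L2) : (c *: f : L2) =1 (fun x => c * f x).
Proof. by []. Qed.

Lemma ip_sqr (f : L2) : (ip f f)%:E = (\int[mu]_x (f x ^+ 2)%:E)%E.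
Proof.
rewrite /ip /Rintegral fineK; first by under eq_integral do rewrite -expr2.
by apply: integrable_fin_num => //; exact: integrable_L2M.
Qed.

Definition L2form (f g : L2) : R := ip f g.

Lemma L2form_semi_inner : semi_inner L2form.
Proof.
rewrite /L2form; split=> [f g|f g h|c f g|f].
- by apply: eq_Rintegral => x _; rewrite mulrC.
- rewrite -RintegralD//; [|exact: integrable_L2M..].
  by apply: eq_Rintegral => x _; rewrite L2_addE mulrDl.
- rewrite -RintegralZl//; last exact: integrable_L2M.
  by apply: eq_Rintegral => x _; rewrite L2_scaleE mulrA.
- by apply: Rintegral_ge0 => x _; rewrite -expr2 sqr_ge0.
Qed.

Lemma sum_half_le2 n : \sum_(k < n) (2^-1 : R) ^+ k <= 2.
Proof.
suff -> : \sum_(k < n) (2^-1 : R) ^+ k = 2 - 2 * 2^-1 ^+ n.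
  by rewrite lerBlDr lerDl mulr_ge0// exprn_ge0.
elim: n => [|n IH]; first by rewrite big_ord0 expr0; ring.
by rewrite big_ord_recr/= IH exprS; lra.
Qed.

(** If [\int (w (k+1) - w k)^2 <= 4^-k], then [\sum 2^k (w (k+1) - w k)^2] has a
    finite integral, hence is finite almost everywhere; there the increments are
    absolutely summable, because [|t| <= 2^-k + 2^k t^2], and [w] converges.  The
    rate of convergence in norm then follows from Fatou's lemma. *)
Lemma L2_complete : fast_complete L2form.
Proof.
rewrite /L2form => w hw.
have hwE n m : (n <= m)%N ->
    (\int[mu]_x ((w m x - w n x) ^+ 2)%:E <= (4^-1 ^+ n)%:E)%E.
  by move=> nm; have := hw _ _ nm; rewrite -lee_fin ip_sqr.
have mw n : measurable_fun setT (w n) by exact: L2_measurable.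
pose D k x := w k.+1 x - w k x.
have mD k : measurable_fun setT (D k) by exact: measurable_funB.
pose S k x := (2 ^+ k * D k x ^+ 2)%:E.
have mS k : measurable_fun setT (S k).
  by apply/measurable_EFinP/measurable_funM => //; exact: measurable_funX.
have S0 k x : (0 <= S k x)%E by rewrite lee_fin mulr_ge0 ?sqr_ge0 ?exprn_ge0.
have intS k : (\int[mu]_x S k x <= (2^-1 ^+ k)%:E)%E.
  under eq_integral do rewrite /S EFinM.
  rewrite ge0_integralZl_EFin//; first last.
  - by apply/measurable_EFinP; exact: measurable_funX.
  - by move=> x _; rewrite lee_fin sqr_ge0.
  apply: le_trans (lee_wpmul2l _ (hwE k k.+1 (leqnSn k))) _.
    by rewrite lee_fin exprn_ge0.
  rewrite -EFinM lee_fin -exprMn (_ : 2 * 4^-1 = 2^-1)//; lra.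
have sumS : (\int[mu]_x (\sum_(k <oo) S k x) < +oo)%E.
  rewrite integral_nneseries//; apply: (@le_lt_trans _ _ 2%:E) (ltry _).
  apply: lime_le; first by apply: is_cvg_nneseries => k _ _; exact: integral_ge0.
  apply: nearW => n; apply: (@le_trans _ _ (\sum_(0 <= k < n) (2^-1 ^+ k)%:E)%E).
    exact: lee_sum.
  by rewrite sumEFin lee_fin big_mkord sum_half_le2.
have mSS : measurable_fun setT (fun x => \sum_(k <oo) S k x)%E.
  by apply: ge0_emeasurable_sum => //.
have intSS : mu.-integrable setT (fun x => \sum_(k <oo) S k x)%E.
  apply/integrableP; split => //.
  by under eq_integral do rewrite gee0_abs ?nneseries_ge0//.
have cvgw : {ae mu, forall x, cvgn (fun n => w n x)}.
  apply: filterS (integrable_ae measurableT intSS) => x /(_ I) Sx.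
  have -> : (fun n => w n x) =
      (fun n => w 0%N x + series (telescope (fun n => w n x)) n).
    by apply/funext => n; rewrite -eq_sum_telescope.
  apply: is_cvgD; first exact: is_cvg_cst.
  apply: normed_cvg; apply: nondecreasing_is_cvgn.
    by apply: nondecreasing_series => i _ _ /=.
  exists (2 + fine (\sum_(k <oo) S k x)%E) => _ [n _ <-].
  rewrite /series/=.
  rewrite (@le_trans _ _ (\sum_(0 <= k < n) (2^-1 ^+ k + 2 ^+ k * D k x ^+ 2)))//.
    apply: ler_sum => k _; rewrite /telescope -/(D k x).
    (* |t| <= 1 / a + a t ^ 2, with a = 2 ^ k *)
    rewrite exprVn; set a := 2 ^+ k; have a0 : 0 < a by rewrite exprn_gt0.
    rewrite -(@ler_pM2l _ a)// mulrDr mulfV ?gt_eqF//.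
    set t := `|_|; have -> : D k x ^+ 2 = t ^+ 2 by rewrite real_normK ?num_real.
    have := sqr_ge0 (1 - a * t); have := mulr_ge0 (ltW a0) (normr_ge0 (D k x)).
    by rewrite -/t; lra.
  rewrite big_split/= lerD// ?big_mkord ?sum_half_le2// -lee_fin fineK//.
  rewrite -sumEFin.
  have := @nneseries_lim_ge R (fun k => S k x) xpredT 0 n (fun k _ _ => S0 k x).
  by rewrite big_mkord.
(* an upper limit is measurable and defined everywhere; where [w] diverges, its
   value does not matter *)
pose gE x := limn_esup (fun n => (w n x)%:E).
pose g x := fine (gE x).
have mg : measurable_fun setT g.
  apply: measurableT_comp => //.
  by apply: measurable_fun_limn_esup => n; exact/measurable_EFinP.
have cvg_g : {ae mu, forall x, w n x @[n --> \oo] --> g x}.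
  apply: filterS cvgw => x /cvg_ex[l wl].
  suff -> : g x = l by [].
  have wlE : (w n x)%:E @[n --> \oo] --> l%:E by apply: cvg_EFin => //; exact: nearW.
  by rewrite /g /gE; have [_ ->] := cvg_limn_einf_sup wlE.
have near_g n : (\int[mu]_x ((g x - w n x) ^+ 2)%:E <= (4^-1 ^+ n)%:E)%E.
  pose F m x := ((w (m + n)%N x - w n x) ^+ 2)%:E.
  have mF m : measurable_fun setT (F m).
    by apply/measurable_EFinP/measurable_funX/measurable_funB.
  have F0 m x : setT x -> (0 <= F m x)%E by move=> _; rewrite lee_fin sqr_ge0.
  have -> : (\int[mu]_x ((g x - w n x) ^+ 2)%:E = \int[mu]_x limn_einf (F^~ x))%E.
    apply: ge0_ae_eq_integral => //.
    - by apply/measurable_EFinP/measurable_funX/measurable_funB.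
    - apply: measurableT_comp => //; apply: measurable_fun_limn_esup => m.
      exact: measurableT_comp.
    - by move=> x _; rewrite lee_fin sqr_ge0.
    - move=> x _; rewrite limn_einf_lim; apply: lime_ge; first exact: is_cvg_einfs.
      by apply: nearW => m; apply: le_ereal_inf_tmp => _ [p /= _ <-]; exact: F0.
    - apply: filterS cvg_g => x wg _.
      have wg' : w (m + n)%N x @[m --> \oo] --> g x.
        by have := wg; rewrite -(cvg_shiftn n (fun m => w m x)).
      have wgB := cvgB wg' (cvg_cst (w n x)).
      suff FgE : F m x @[m --> \oo] --> ((g x - w n x) ^+ 2)%:E.
        by have [-> _] := cvg_limn_einf_sup FgE.
      apply: cvg_EFin; first exact: nearW.
      by rewrite expr2; apply: cvgM; exact: wgB.
  apply: le_trans (fatou _ measurableT mF F0) _.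
  rewrite limn_einf_lim; apply: lime_le; first exact: is_cvg_einfs.
  apply: nearW => m; apply: le_trans (hwE n (m + n)%N (leq_addl _ _)).
  by apply: ereal_inf_lbound; exists m => /=.
have near_lty n : (\int[mu]_x ((g x - w n x) ^+ 2)%:E < +oo)%E.
  by apply: le_lt_trans (near_g n) _; rewrite ltry.
have [v0 v0E] : {f : L2 | f =1 (fun x => g x - w 0%N x)}.
  by apply: L2_intro => //; exact: measurable_funB.
exists (v0 + w 0%N), 1 => n; rewrite mulr1 -lee_fin ip_sqr.
apply: le_trans (near_g n); rewrite le_eqVlt; apply/orP; left; apply/eqP.
by apply: eq_integral => x _; rewrite !L2_addE v0E subrK.
Qed.

End SquareIntegrable.

(** * Measurability and integrability in the plane *)

Section Plane.
Context {R : realType}.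
Implicit Types (h g : R * R -> R) (i j : bool) (p q : R * R) (t : R).

(* [R] has several convertible measurable structures; Lebesgue measure lives on
   [measurableTypeR R]. *)
Local Notation plane := (measurableTypeR R * measurableTypeR R)%type.
Local Notation sigma := (@lebesgue_measure R \x @lebesgue_measure R)%E.

(** The measurable sets are those of the product sigma-algebra, so an open set has
    to be exhausted by countably many boxes. *)
Lemma open_measurable_plane (U : set (R * R)) : open U -> @measurable _ plane U.
Proof.
move=> oU.
pose box (c : (rat * rat) * nat) : set (R * R) :=
  ball (ratr c.1.1 : R) (c.2.+1%:R^-1) `*` ball (ratr c.1.2 : R) (c.2.+1%:R^-1).
have -> : U = \bigcup_(c in [set c | box c `<=` U]) box c.
  apply/seteqP; split=> [[x y] Uxy|p [c cU cp]]; last exact: cU.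
  have /nbhs_ballP[e /= e0 eU] : nbhs (x, y) U by exact: open_nbhs_nbhs.
  have [n ne] : exists n : nat, n.+1%:R^-1 < e / 2.
    exists (Num.truncn (2 / e)); rewrite -[e / 2]invrK ltf_pV2 ?posrE ?invr_gt0 ?divr_gt0//.
    by rewrite invf_div truncnS_gt.
  have n0 : 0 < n.+1%:R^-1 :> R by rewrite invr_gt0.
  have near_rat (z : R) : exists r : rat, `|ratr r - z| < n.+1%:R^-1.
    have : z - n.+1%:R^-1 < z + n.+1%:R^-1 by rewrite ltrBlDr -addrA ltrDl addr_gt0.
    move=> /rat_in_itvoo[r]; rewrite in_itv/= => /andP[r1 r2].
    by exists r; rewrite ltr_distl r1 r2.
  have [r1 h1] := near_rat x; have [r2 h2] := near_rat y.
  exists ((r1, r2), n) => /=; last by split.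
  move: ne h1 h2; rewrite /box/=; move: (n.+1%:R^-1) => r ne h1 h2.
  move=> [u v] [/= hu hv]; apply: eU; split; rewrite /ball/= in hu hv *.
    have := ler_distD (ratr r1) x u; rewrite (distrC x (ratr r1)); lra.
  have := ler_distD (ratr r2) y v; rewrite (distrC y (ratr r2)); lra.
rewrite bigcup_mkcond; apply: countable_bigcupT_measurable => // c.
case: ifP => // _; apply: measurableX; exact: measurable_ball.
Qed.

Lemma continuous_measurable_plane h : continuous h -> @measurable_fun _ _ plane R setT h.
Proof.
move=> ch; apply: (measurability _ (RGenOpens.measurableE R)) => _ [_ [a [b ->] <-]].
rewrite [_ `&` _]setTI; apply: open_measurable_plane.
by move/continuousP: ch; apply; exact: interval_open.
Qed.

Lemma closed_measurable_plane (K : set (R * R)) : closed K -> @measurable _ plane K.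
Proof.
move=> cK; rewrite -[K]setCK; apply: measurableC.
by apply: open_measurable_plane; exact: closed_openC.
Qed.

Definition bounded_support h := exists M : R, forall p, M < `|p| -> h p = 0.

Lemma integrable_bounded_support h : continuous h -> bounded_support h ->
  sigma.-integrable setT (EFin \o h).
Proof.
move=> ch [M hM].
pose K : set (R * R) := `[- M, M]%classic `*` `[- M, M]%classic.
have cK : compact K by apply: compact_setX; exact: segment_compact.
have mK : @measurable _ plane K by apply: measurableX.
have -> : EFin \o h = (EFin \o h) \_ K.
  apply/funext => p; rewrite patchE; case: ifPn => //= pK.
  congr EFin; apply: hM; rewrite ltNge; apply: contra pK => pM.
  rewrite inE; move: pM; rewrite /Num.norm/= num_ge_max => /andP[p1 p2].
  by split; rewrite /= in_itv/= -ler_norml.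
apply: (@integrable_mkcond _ plane R sigma _ _ mK).1.
apply: measurable_bounded_integrable => //.
- pose I : set R := `[- M, M]%classic.
  apply: (@le_lt_trans _ _ (lebesgue_measure I * lebesgue_measure I)%E).
    by rewrite le_eqVlt; apply/orP; left; apply/eqP; exact: product_measure1E.
  rewrite lebesgue_measure_itv/=.
  by case: ifP => _; rewrite ?mul0e// -EFinD -EFinM ltry.
- exact: measurable_funS (continuous_measurable_plane ch).
- have [N [Nr HN]] := compact_bounded (continuous_compact (continuous_subspaceT ch) cK).
  by exists N; split=> // x Nx p Kp; apply: HN => //; exists p.
Qed.

End Plane.

(** * Partial derivatives and smoothness *)

Section Partial.
Context {R : realType}.
Implicit Types (f h g : R * R -> R) (i j : bool) (p q : R * R) (t : R).

(** The two coordinates are indexed by a boolean, [true] for the first one, so that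
    [~~ i] is the other coordinate and each statement is proved once. *)
Definition coord i p : R := if i then p.1 else p.2.

Definition slide i p t : R * R := if i then (t, p.2) else (p.1, t).

Lemma slide_coord i p : slide i p (coord i p) = p.
Proof. by case: i p => -[]. Qed.

Lemma coord_slide i p t : coord i (slide i p t) = t.
Proof. by case: i. Qed.

Lemma coord_slideN i p t : coord (~~ i) (slide i p t) = coord (~~ i) p.
Proof. by case: i. Qed.

Lemma slide_slide i p s t : slide i (slide i p s) t = slide i p t.
Proof. by case: i. Qed.

Lemma slide_swap i p s t : slide (~~ i) (slide i p s) t = slide i (slide (~~ i) p t) s.
Proof. by case: i. Qed.

Lemma continuous_slide i p : continuous (slide i p).
Proof.
case: i => t U /nbhs_ballP[e /= e0 eU]; apply/nbhs_ballP; exists e => //= s ts.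
  by apply: eU; split => //=; exact: ballxx.
by apply: eU; split => //=; exact: ballxx.
Qed.

Lemma continuous_coord i : continuous (coord i).
Proof. by case: i => p; [exact: cvg_fst|exact: cvg_snd]. Qed.

Definition partial i h p : R := derive1 (h \o slide i p) (coord i p).

Definition has_partial i h := forall p, derivable (h \o slide i p) (coord i p) 1.

Lemma is_derive_slide i h p t : has_partial i h ->
  is_derive t (1 : R) (h \o slide i p) (partial i h (slide i p t)).
Proof.
move=> /(_ (slide i p t)); rewrite coord_slide => dh.
have E : h \o slide i (slide i p t) = h \o slide i p.
  by apply/funext => s /=; rewrite slide_slide.
rewrite /partial coord_slide E derive1E; rewrite E in dh.
exact: DeriveDef.
Qed.

Lemma is_derive_coord i h p : has_partial i h ->
  is_derive (coord i p) (1 : R) (h \o slide i p) (partial i h p).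
Proof. by move=> /is_derive_slide - /(_ p (coord i p)); rewrite slide_coord. Qed.

(** Differentiability and the value of the derivative are computed together: the
    total function [partial] has the usual rules only where the derivative exists. *)
Lemma partial_val i h (dh : R * R -> R) :
  (forall p, is_derive (coord i p) (1 : R) (h \o slide i p) (dh p)) ->
  has_partial i h /\ partial i h = dh.
Proof.
move=> H; split=> [p|]; first by have [] := H p.
by apply/funext => p; rewrite /partial derive1E; have [_ ->] := H p.
Qed.

Fixpoint smC n h : Prop :=
  if n is m.+1 then
    [/\ continuous h, forall i, has_partial i h & forall i, smC m (partial i h)]
  else continuous h.

Lemma smC_continuous n h : smC n h -> continuous h.
Proof. by case: n => // n []. Qed.

Lemma smCS n h : smC n.+1 h -> smC n h.
Proof.
elim: n h => [|n IH] h; first by case.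
by move=> [ch dh ph]; split=> // i; exact: IH.
Qed.

Lemma partialD i f g : has_partial i f -> has_partial i g ->
  has_partial i (f \+ g) /\ partial i (f \+ g) = partial i f \+ partial i g.
Proof.
move=> df dg; apply: partial_val => p.
exact: is_deriveD (is_derive_coord p df) (is_derive_coord p dg).
Qed.

Lemma partialM i f g : has_partial i f -> has_partial i g ->
  has_partial i (f \* g) /\
  partial i (f \* g) = (f \* partial i g) \+ (g \* partial i f).
Proof.
move=> df dg; apply: partial_val => p.
have := is_deriveM (is_derive_coord p df) (is_derive_coord p dg).
by rewrite /= slide_coord.
Qed.

Lemma partial_cst i (c : R) : has_partial i (cst c) /\ partial i (cst c) = cst 0.
Proof. by apply: partial_val => p; exact: is_derive_cst. Qed.

Lemma partial_coord i : has_partial i (coord i) /\ partial i (coord i) = cst 1.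
Proof.
apply: partial_val => p; rewrite (_ : _ \o _ = id); first exact: is_derive_id.
by apply/funext => t /=; rewrite coord_slide.
Qed.

Lemma partial_coordN i j :
  i != j -> has_partial i (coord j) /\ partial i (coord j) = cst 0.
Proof.
move=> ij; apply: partial_val => p.
rewrite (_ : _ \o _ = cst (coord j p)); first exact: is_derive_cst.
by apply/funext => t /=; case: i j ij => -[].
Qed.

Lemma smC_cst n (c : R) : smC n (cst c).
Proof.
elim: n c => [|n IH] c; first by move=> p; exact: cvg_cst.
split=> [p|i|i]; [exact: cvg_cst|exact: (partial_cst i c).1|].
by rewrite (partial_cst i c).2.
Qed.

Lemma smC_coord n i : smC n (coord i).
Proof.
case: n => [|n]; first exact: continuous_coord.
split=> [|j|j]; first exact: continuous_coord.
  by have [<-|ij] := eqVneq j i; [exact: (partial_coord _).1|exact: (partial_coordN ij).1].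
have [->|ji] := eqVneq j i; first by rewrite (partial_coord _).2; exact: smC_cst.
by rewrite (partial_coordN ji).2; exact: smC_cst.
Qed.

Lemma smCD n f g : smC n f -> smC n g -> smC n (f \+ g).
Proof.
elim: n f g => [|n IH] f g; first by move=> cf cg p; apply: cvgD; [exact: cf|exact: cg].
move=> [cf df pf] [cg dg pg]; split=> [p|i|i]; first by apply: cvgD; [exact: cf|exact: cg].
  exact: (partialD (df i) (dg i)).1.
by rewrite (partialD (df i) (dg i)).2; apply: IH; [exact: pf|exact: pg].
Qed.

Lemma smCM n f g : smC n f -> smC n g -> smC n (f \* g).
Proof.
elim: n f g => [|n IH] f g; first by move=> cf cg p; apply: cvgM; [exact: cf|exact: cg].
move=> hf hg; have [hf' hg'] := (smCS hf, smCS hg).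
move: hf hg => [cf df pf] [cg dg pg]; split=> [p|i|i].
- by apply: cvgM; [exact: cf|exact: cg].
- exact: (partialM (df i) (dg i)).1.
- by rewrite (partialM (df i) (dg i)).2; apply: smCD; apply: IH => //; [exact: pg|exact: pf].
Qed.

Lemma partial_expR i h : has_partial i h ->
  has_partial i (expR \o h) /\ partial i (expR \o h) = (expR \o h) \* partial i h.
Proof.
move=> dh; apply: partial_val => p.
have h1 := is_derive_coord p dh.
have := @is_derive1_comp _ expR (h \o slide i p) (coord i p) _ _ (is_derive_expR _) h1.
by rewrite /= slide_coord.
Qed.

Lemma smC_expR n h : smC n h -> smC n (expR \o h).
Proof.
have cexp f : continuous f -> continuous (expR \o f).
  by move=> cf p; apply: continuous_comp; [exact: cf|exact: continuous_expR].
elim: n h => [|n IH] h hh; first exact: cexp.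
have hh' := smCS hh; case: hh => [ch dh ph]; split; first exact: cexp.
  by move=> i; exact: (partial_expR (dh i)).1.
by move=> i; rewrite (partial_expR (dh i)).2; apply: smCM; [exact: IH|exact: ph].
Qed.

End Partial.

(** * Symmetry of second derivatives, integration by parts *)

Section PlaneCalculus.
Context {R : realType}.
Implicit Types (f h g : R * R -> R) (i j : bool) (p q : R * R) (t : R).

Local Notation sigma := (@lebesgue_measure R \x @lebesgue_measure R)%E.

Lemma partial_MVT i h p (e : R) : has_partial i h -> 0 < e ->
  exists2 t, coord i p < t < coord i p + e &
    h (slide i p (coord i p + e)) - h p = e * partial i h (slide i p t).
Proof.
move=> dh e0; set a := coord i p.
have dF t := is_derive_slide p t dh.
have ab : a < a + e by rewrite ltrDl.
have [|t] := MVT ab (fun t _ => dF t).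
  by apply: derivable_within_continuous => t _; have [] := dF t.
rewrite in_itv/= slide_coord addrAC subrr add0r mulrC => tab E.
by exists t.
Qed.

(** The mean value theorem, once along each coordinate.  The left-hand side is
    symmetric in the two coordinates, which is what [partial_comm] exploits. *)
Lemma second_difference i h p (e : R) : smC 2 h -> 0 < e ->
  exists2 q, ball p e q &
    h (slide (~~ i) (slide i p (coord i p + e)) (coord (~~ i) p + e))
    - h (slide i p (coord i p + e)) - h (slide (~~ i) p (coord (~~ i) p + e)) + h p
    = e * (e * partial (~~ i) (partial i h) q).
Proof.
move=> [ch dh ph] e0; set a := coord i p; set b := coord (~~ i) p.
pose F q := h (slide (~~ i) q (b + e)) - h q.
have FE q : F q = h (slide (~~ i) q (b + e)) + (- h q) by [].
have dF q : is_derive (coord i q) (1 : R) (F \o slide i q)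
    (partial i h (slide (~~ i) q (b + e)) - partial i h q).
  have -> : F \o slide i q = (h \o slide i (slide (~~ i) q (b + e))) - (h \o slide i q).
    apply/funext => t /=; rewrite /F -[RHS]/(_ (slide _ _ t) - h (slide i q t)).
    by congr (h _ - _); case: (i).
  apply: is_deriveB; last exact: is_derive_coord.
  have := is_derive_slide (slide (~~ i) q (b + e)) (coord i q) (dh i).
  by congr (is_derive _ _ _ (partial i h _)); case: (i) q => -[].
have [dF1 dF2] := partial_val dF.
have [s sa Es] := partial_MVT p dF1 e0.
have [|t tb Et] := @partial_MVT (~~ i) (partial i h) (slide i p s) e _ e0.
  by case: (ph i) => _ dph _; exact: dph.
rewrite coord_slideN -/b in tb Et.
exists (slide (~~ i) (slide i p s) t).
  move: sa tb; rewrite /a /b; case: (i) => /= sa tb; split;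
    by rewrite /ball/= distrC ger0_norm; lra.
rewrite -Et; move: Es; rewrite dF2 -/a => <-; rewrite /F; ring.
Qed.

Let cancel_sqr (r x y a b : R) : 0 < r -> x = r * (r * a) -> y = r * (r * b) ->
  x = y -> a = b.
Proof.
by move=> r0 -> -> /(mulfI (lt0r_neq0 r0))/(mulfI (lt0r_neq0 r0)).
Qed.

Let dist_half (x y v e : R) : `|x - v| < e / 2 -> `|y - v| < e / 2 -> `|x - y| <= e.
Proof. by move=> h1 h2; have := ler_distD v x y; rewrite (distrC v y); lra. Qed.

(** Both mixed derivatives are values of the same difference quotient at points
    close to [p]; continuity lets these points tend to [p]. *)
Lemma partial_comm i h : smC 2 h ->
  partial (~~ i) (partial i h) = partial i (partial (~~ i) h).
Proof.
move=> hh; apply/funext => p.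
have [_ _ ph] := hh.
have c1 : continuous (partial (~~ i) (partial i h)).
  by have [_ _ ] := ph i; apply.
have c2 : continuous (partial i (partial (~~ i) h)).
  by have [_ _ ] := ph (~~ i); apply.
apply/eqP; rewrite -subr_eq0 -normr_le0; apply/ler_addgt0Pr => e e0; rewrite add0r.
have e2 : 0 < e / 2 by rewrite divr_gt0.
have /nbhs_ballP[r1 /= r10 b1] := c1 p _ (nbhsx_ballx _ _ e2).
have /nbhs_ballP[r2 /= r20 b2] := c2 p _ (nbhsx_ballx _ _ e2).
pose r := Num.min r1 r2; have r0 : 0 < r by rewrite lt_min r10.
have [q1 pq1 E1] := second_difference i p hh r0.
have [q2 pq2] := second_difference (~~ i) p hh r0.
rewrite negbK => E2.
have {E1 E2} E : partial (~~ i) (partial i h) q1 = partial i (partial (~~ i) h) q2.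
  by apply: (cancel_sqr r0 E1 E2); rewrite slide_swap (addrAC (h _)).
have r_le1 : r <= r1 by rewrite ge_min lexx.
have r_le2 : r <= r2 by rewrite ge_min lexx orbT.
have := b1 q1 (le_ball r_le1 pq1); have := b2 q2 (le_ball r_le2 pq2).
by rewrite /ball/= -E => h2 h1; exact: dist_half h1 h2.
Qed.

Lemma bounded_support_partial i h : bounded_support h -> bounded_support (partial i h).
Proof.
move=> [M hM]; exists M => p Mp; rewrite /partial derive1E.
rewrite -[RHS](@derive_cst _ _ _ (0 : R) (coord i p) 1).
apply: near_eq_derive.
have : nbhs (slide i p (coord i p)) [set q | M < `|q|].
  rewrite slide_coord; apply: open_nbhs_nbhs; split=> //.
  rewrite (_ : mkset _ = (fun q => `|q|) @^-1` `]M, +oo[%classic).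
    apply: open_comp; last exact: interval_open.
    by move=> x _; exact: norm_continuous.
  by apply/seteqP; split => q /=; rewrite in_itv/= andbT.
move=> U; have : \forall t \near coord i p, M < `|slide i p t|.
  exact: continuous_slide U.
by apply: filterS => t /= /hM.
Qed.

Lemma norm_slide i p t : `|t| <= `|slide i p t|.
Proof. by case: i; rewrite /Num.norm/= le_max lexx ?orbT. Qed.

Lemma integral_derive_compact (u : R -> R) (M : R) :
  (forall t, derivable u t 1) -> continuous (derive1 u) ->
  (forall t, M < `|t| -> u t = 0) -> (forall t, M < `|t| -> derive1 u t = 0) ->
  (\int[@lebesgue_measure R]_t (derive1 u t)%:E = 0)%E.
Proof.
move=> du cu u0 du0; pose N := `|M| + 1.
have MN : M < N by rewrite /N; have := ler_norm M; lra.
have N0 : 0 < N by rewrite /N; have := normr_ge0 M; lra.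
rewrite (_ : (fun t => _) = (EFin \o derive1 u) \_ `[- N, N]).
  rewrite -integral_mkcond; transitivity ((u N)%:E - (u (- N))%:E)%E; last first.
    by rewrite !u0 ?subee// ?normrN ger0_norm// ltW.
  have cont_u t : u @ t --> u t by apply/differentiable_continuous/derivable1_diffP.
  apply: (@continuous_FTC2 R (derive1 u) u (- N) N).
  - by rewrite gtrN.
  - exact: continuous_subspaceT.
  - split=> [t _||]; first exact: du.
      exact: cvg_at_right_filter.
    exact: cvg_at_left_filter.
  - by [].
apply/funext => t; rewrite patchE; case: ifPn => //= tN; rewrite du0//.
apply: lt_le_trans MN _; rewrite leNgt; apply: contra tN => tN.
by rewrite inE/= in_itv/= -ler_norml ltW.
Qed.

(** By Fubini the integral is taken first along the lines parallel to axis [i], on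
    which it vanishes by the fundamental theorem of calculus. *)
Lemma integral_partial i g : smC 1 g -> bounded_support g ->
  (\int[sigma]_p (partial i g p)%:E = 0)%E.
Proof.
move=> [cg dg pg] sg.
have ig := integrable_bounded_support (pg i) (bounded_support_partial i sg).
have line p : (\int[@lebesgue_measure R]_t (partial i g (slide i p t))%:E = 0)%E.
  have [M gM] := sg; have [M' gM'] := bounded_support_partial i sg.
  have dE : (fun t => partial i g (slide i p t)) = derive1 (g \o slide i p).
    by apply/funext => t; have [_ <-] := is_derive_slide p t (dg i); rewrite derive1E.
  rewrite (_ : (fun t => _) = (fun t => (derive1 (g \o slide i p) t)%:E));
    last by rewrite -dE.
  apply: (@integral_derive_compact _ (Num.max M M')).
  - by move=> t; have [] := is_derive_slide p t (dg i).
  - rewrite -dE => t; apply: continuous_comp; [exact: continuous_slide|exact: pg].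
  - move=> t; rewrite gt_max => /andP[Mt _]; apply: gM.
    exact: lt_le_trans (norm_slide _ _ _).
  - move=> t; rewrite gt_max => /andP[_ Mt]; rewrite -dE; apply: gM'.
    exact: lt_le_trans (norm_slide _ _ _).
case: i ig line => ig line.
  rewrite -integral21_prod_meas1//; apply: integral0_eq => y _.
  exact: (line (0, y)).
rewrite -integral12_prod_meas1//; apply: integral0_eq => x _.
exact: (line (x, 0)).
Qed.

End PlaneCalculus.

(** * Test functions and the weighted scalar product *)

Section TestFunctions.
Context {R : realType}.
Implicit Types (i j : bool) (p : R * R).

Local Notation plane := (measurableTypeR R * measurableTypeR R)%type.
Local Notation sigma := (@lebesgue_measure R \x @lebesgue_measure R)%E.

Definition smooth (h : R * R -> R) := forall n, smC n h.

Definition compact_smooth : {pred (R * R -> R)} :=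
  fun h => `[< smooth h /\ bounded_support h >].

Record testfun := TestFun {
  testfun_val :> R * R -> R;
  testfunP : testfun_val \in compact_smooth }.

HB.instance Definition _ := [isSub for testfun_val].
HB.instance Definition _ := [Choice of testfun by <:].

Lemma smooth_partial i h : smooth h -> smooth (partial i h).
Proof. by move=> sh n; case: (sh n.+1) => _ _; exact. Qed.

Lemma smooth_has_partial i h : smooth h -> has_partial i h.
Proof. by move=> /(_ 1)[]. Qed.
Arguments smooth_has_partial i [h].

Lemma smoothD f g : smooth f -> smooth g -> smooth (f + g).
Proof. by move=> sf sg n; exact: smCD. Qed.

Lemma smoothM f g : smooth f -> smooth g -> smooth (f \* g).
Proof. by move=> sf sg n; exact: smCM. Qed.

Lemma smoothZ (c : R) f : smooth f -> smooth (c *: f).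
Proof. by move=> sf; apply: smoothM => // n; exact: smC_cst. Qed.

Lemma bounded_supportD f g : bounded_support f -> bounded_support g ->
  @bounded_support R (f + g).
Proof.
move=> [M fM] [N gN]; exists (Num.max M N) => p; rewrite gt_max => /andP[Mp Np].
by rewrite -[LHS]/(f p + g p) fM// gN// addr0.
Qed.

Lemma bounded_supportMr (f g : R * R -> R) : bounded_support g -> bounded_support (f \* g).
Proof. by move=> [N gN]; exists N => p Np /=; rewrite gN// mulr0. Qed.

Lemma compact_smoothP h : reflect (smooth h /\ bounded_support h) (h \in compact_smooth).
Proof. exact: asboolP. Qed.

Lemma compact_smooth_submod : submod_closed compact_smooth.
Proof.
split; first by apply/compact_smoothP; split; [move=> n; exact: smC_cst | exists 0].
move=> c f g /compact_smoothP[sf bf] /compact_smoothP[sg bg]; apply/compact_smoothP.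
split; first by apply: smoothD => //; exact: smoothZ.
by apply: bounded_supportD => //; exact: bounded_supportMr.
Qed.

HB.instance Definition _ :=
  GRing.isSubmodClosed.Build _ _ compact_smooth compact_smooth_submod.
HB.instance Definition _ := [SubChoice_isSubLmodule of testfun by <:].

Lemma testfun_smooth (h : testfun) : smooth h.
Proof. by have /compact_smoothP[] := testfunP h. Qed.

Lemma testfun_support (h : testfun) : bounded_support h.
Proof. by have /compact_smoothP[] := testfunP h. Qed.

Lemma testfun_eq (f g : testfun) : f =1 g -> f = g.
Proof. by move=> fg; apply/val_inj/funext. Qed.

Lemma testfunNE (f : testfun) : (- f : testfun) =1 (fun p => - f p). Proof. by []. Qed.

Lemma partial_compact_smooth i (h : testfun) : partial i h \in compact_smooth.
Proof.
apply/compact_smoothP; split; first exact: smooth_partial (testfun_smooth h).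
exact: bounded_support_partial (testfun_support h).
Qed.
Definition tpartial i (h : testfun) : testfun := TestFun (partial_compact_smooth i h).

Lemma partial_linear i c (f g : testfun) :
  partial i (c *: f + g : testfun) = (fun p => c * partial i f p + partial i g p).
Proof.
have df := smooth_has_partial i (testfun_smooth f).
have dg := smooth_has_partial i (testfun_smooth g).
have [dc ec] := partial_cst i c.
have [dcf ecf] := partialM dc df; have [_ E] := partialD dcf dg.
rewrite -[X in partial _ X]/((cst c \* f) \+ g) E ecf ec.
by apply/funext => p /=; rewrite mulr0 addr0.
Qed.

Lemma tpartial_is_linear i : linear (tpartial i).
Proof. by move=> c f g; apply: testfun_eq => p; rewrite /= partial_linear. Qed.
HB.instance Definition _ i :=
  GRing.isLinear.Build R testfun testfun _ (tpartial i) (tpartial_is_linear i).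

Lemma adj_compact_smooth i (h : testfun) :
  (fun p => - partial i h p - 2 * coord i p * h p) \in compact_smooth.
Proof.
rewrite (_ : (fun p => _) = (-1 : R) *: partial i h + ((-2 : R) *: coord i) \* h); last first.
  apply/funext => p.
  rewrite -[RHS]/(-1 * partial i h p + (-2 * coord i p) * h p); ring.
apply/compact_smoothP; split.
  apply: smoothD; first by apply/smoothZ/smooth_partial; exact: testfun_smooth.
  apply: smoothM (testfun_smooth h); apply: smoothZ => n; exact: smC_coord.
apply: bounded_supportD; last exact: bounded_supportMr (testfun_support h).
by apply/bounded_supportMr/bounded_support_partial; exact: testfun_support.
Qed.
(** The adjoint of the partial derivative for the weight [exp (x^2 + y^2)], see
    [tpartial_adj]. *)
Definition tadj i (h : testfun) : testfun := TestFun (adj_compact_smooth i h).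

Lemma tadj_is_linear i : linear (tadj i).
Proof.
move=> c f g; apply: testfun_eq => p.
rewrite -[RHS]/(c * tadj i f p + tadj i g p) /= partial_linear.
by rewrite -[(c *: _ + _) p]/(c * f p + g p); ring.
Qed.
HB.instance Definition _ i :=
  GRing.isLinear.Build R testfun testfun _ (tadj i) (tadj_is_linear i).

Lemma partial_tadj i j (h : testfun) p :
  partial j (tadj i h) p = - partial j (partial i h) p
    - 2 * (coord i p * partial j h p + h p * partial j (coord i) p).
Proof.
have dh := smooth_has_partial j (testfun_smooth h).
have dp := smooth_has_partial j (testfun_smooth (tpartial i h)).
have dc := smooth_has_partial j (fun n => @smC_coord R n i).
have [dm1 em1] := partial_cst j (-1 : R).
have [dm2 em2] := partial_cst j (-2 : R).
have [d1 e1] := partialM dm1 dp.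
have [d2 e2] := partialM dc dh.
have [d3 e3] := partialM dm2 d2.
have [_ e] := partialD d1 d3.
rewrite (_ : testfun_val (tadj i h)
  = (cst (-1) \* tpartial i h) \+ (cst (-2) \* (coord i \* h))); last first.
  by apply/funext => q /=; ring.
by rewrite e e1 e3 e2 em1 em2 /=; ring.
Qed.

Lemma tpartial_ccr i h : tadj i (tpartial i h) = tpartial i (tadj i h) + 2 *: h.
Proof.
apply: testfun_eq => p.
rewrite -[RHS]/(partial i (tadj i h) p + 2 * h p) partial_tadj /=.
by rewrite (partial_coord i).2 /=; ring.
Qed.

Lemma tpartial_comm i h : tadj i (tpartial (~~ i) h) = tpartial (~~ i) (tadj i h).
Proof.
apply: testfun_eq => p; rewrite /= partial_tadj /=.
have ni : ~~ i != i by case: i.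
by rewrite (partial_coordN ni).2 (partial_comm i (testfun_smooth h 2)) /=; ring.
Qed.

(** The scalar product of test functions has weight [exp (x^2 + y^2)].  It is
    obtained from the unweighted one by multiplying each factor with the square
    root [wt] of this weight. *)
Definition half_sqnorm p : R := 2^-1 * (p.1 * p.1 + p.2 * p.2).
Definition wt : R * R -> R := expR \o half_sqnorm.

Lemma smooth_half_sqnorm : smooth half_sqnorm.
Proof.
have -> : half_sqnorm = (2^-1 : R) *: (coord true \* coord true + coord false \* coord false).
  by [].
by apply/smoothZ/smoothD; apply/smoothM => n; exact: smC_coord.
Qed.

Lemma smooth_wt : smooth wt.
Proof. by move=> n; apply: smC_expR; exact: smooth_half_sqnorm. Qed.

Lemma partial_half_sqnorm i : partial i half_sqnorm = coord i.
Proof.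
apply/funext => p.
have dc j := smooth_has_partial i (fun n => @smC_coord R n j).
have [d1 e1] := partialM (dc true) (dc true).
have [d2 e2] := partialM (dc false) (dc false).
have [d3 e3] := partialD d1 d2.
have [dh eh] := partial_cst i (2^-1 : R).
have [_ e] := partialM dh d3.
rewrite -[half_sqnorm]/(cst 2^-1 \*
  ((coord true \* coord true) \+ (coord false \* coord false))).
rewrite e e3 e1 e2 eh /=.
case: i {dc d1 d2 d3 dh e e1 e2 e3 eh} => /=.
  by rewrite (@partial_coord R true).2 (@partial_coordN R true false isT).2 /=; field.
by rewrite (@partial_coord R false).2 (@partial_coordN R false true isT).2 /=; field.
Qed.

Lemma partial_wt i : partial i wt = wt \* coord i.
Proof.
by rewrite (partial_expR (smooth_has_partial i smooth_half_sqnorm)).2 partial_half_sqnorm.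
Qed.

Lemma wt_gt0 p : 0 < wt p. Proof. exact: expR_gt0. Qed.

Local Notation L2plane := (@L2 _ plane R sigma).

Lemma L2_compact_smooth (h : testfun) : {f : L2plane | f =1 wt \* h}.
Proof.
have sh : smooth (wt \* h) by apply: smoothM (testfun_smooth h); exact: smooth_wt.
have bh : bounded_support (wt \* h) by apply: bounded_supportMr; exact: testfun_support.
apply: L2_intro; first exact: continuous_measurable_plane (smC_continuous (sh 0%N)).
have ss := smC_continuous (smoothM sh sh 0%N).
have /integrableP[_] := integrable_bounded_support ss (bounded_supportMr (wt \* h) bh).
apply: le_lt_trans; rewrite le_eqVlt; apply/orP; left; apply/eqP.
by apply: eq_integral => p _ /=; rewrite ger0_norm -?expr2// sqr_ge0.
Qed.

Definition weighted (h : testfun) : L2plane := sval (L2_compact_smooth h).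

Lemma weightedE h : weighted h =1 wt \* h.
Proof. exact: svalP (L2_compact_smooth h). Qed.

Lemma weighted_is_linear : linear weighted.
Proof.
move=> c f g; apply/LfuneqP => p.
rewrite L2_addE L2_scaleE !weightedE /=.
by rewrite -[(c *: _ + _) p]/(c * f p + g p); ring.
Qed.
HB.instance Definition _ :=
  GRing.isLinear.Build R testfun L2plane _ weighted weighted_is_linear.

Definition testform (f g : testfun) : R := L2form (weighted f) (weighted g).

Lemma testform_semi_inner : semi_inner testform.
Proof. exact: (comp_semi_inner weighted (L2form_semi_inner sigma)). Qed.

(** Integration by parts: the difference of the two sides is the integral of
    the derivative of [f g exp (x^2 + y^2)]. *)
Lemma tpartial_adj i f g : testform (tpartial i f) g = testform f (tadj i g).
Proof.
apply/eqP; rewrite -subr_eq0 /testform /L2form /ip -RintegralB//; [|exact: integrable_L2M..].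
pose F := wt \* f; pose G := wt \* g.
have sF : smooth F by exact: smoothM smooth_wt (testfun_smooth f).
have sG : smooth G by exact: smoothM smooth_wt (testfun_smooth g).
have bG : bounded_support G by apply: bounded_supportMr; exact: testfun_support.
have dw := smooth_has_partial i smooth_wt.
have [_ eF] := partialM dw (smooth_has_partial i (testfun_smooth f)).
have [_ eG] := partialM dw (smooth_has_partial i (testfun_smooth g)).
have [_ eFG] := partialM (smooth_has_partial i sF) (smooth_has_partial i sG).
rewrite (_ : Rintegral _ _ _ = fine (\int[sigma]_p (partial i (F \* G) p)%:E)).
  by rewrite (integral_partial i (smoothM sF sG 1%N) (bounded_supportMr F bG)).
congr fine; apply: eq_integral => p _; congr EFin.
rewrite !weightedE eFG /= [partial i F]eF [partial i G]eG partial_wt /F /G /=; ring.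
Qed.

End TestFunctions.

Local Open Scope complex_scope.

(** * Weighted square integrable functions as unweighted pairs *)

Section Representation.
Context {R : realType}.
Implicit Types (p : R * R) (z : R[i]) (g u phi : R[i] -> R[i]).

Local Notation plane := (measurableTypeR R * measurableTypeR R)%type.
Local Notation sigma := (@lebesgue_measure R \x @lebesgue_measure R)%E.
Local Notation L2plane := (@L2 _ plane R sigma).
Local Notation W := (L2plane * L2plane)%type.
Local Notation V := (@testfun R * @testfun R)%type.

Definition plane_form : W -> W -> R := pair_form (@L2form _ plane R sigma).

Lemma plane_form_semi_inner : semi_inner plane_form.
Proof. exact: pair_semi_inner (L2form_semi_inner sigma). Qed.

Lemma plane_form_complete : fast_complete plane_form.
Proof. exact: pair_fast_complete (L2form_semi_inner sigma) (@L2_complete _ _ _ _). Qed.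

(** [g] is [exp (|z|^2 / 2)] times the complex function with components [v]; this
    identifies the weighted L2 space with pairs of unweighted L2 functions. *)
Definition represents g (v : W) := forall p, g (cplx p) = (wt p * v.1 p) +i* (wt p * v.2 p).

Lemma represents_exists (v : W) : exists u, represents u v.
Proof.
exists (fun z => let p := (complex.Re z, complex.Im z) in
  (wt p * v.1 p) +i* (wt p * v.2 p)).
by move=> [x y].
Qed.

Lemma cabs_sqr z : cabs z ^+ 2 = complex.Re z ^+ 2 + complex.Im z ^+ 2.
Proof. by case: z => x y; rewrite /cabs /= sqr_sqrtr// addr_ge0 ?sqr_ge0. Qed.

Lemma gauss_weight p : expR (- cabs (cplx p) ^+ 2) = (wt p ^+ 2)^-1.
Proof.
rewrite cabs_sqr /= expRN /wt /= -expRM_natl; congr (expR _)^-1.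
by rewrite /half_sqnorm; field.
Qed.

Lemma represents_density g v p : represents g v ->
  cabs (g (cplx p)) ^+ 2 * expR (- cabs (cplx p) ^+ 2) = v.1 p ^+ 2 + v.2 p ^+ 2.
Proof.
move=> /(_ p) ->; rewrite gauss_weight cabs_sqr /=.
by field; rewrite gt_eqF// wt_gt0.
Qed.

Lemma measurable_L2sqr (f : L2plane) :
  @measurable_fun _ _ plane (\bar R) setT (fun p => (f p ^+ 2)%:E).
Proof. by apply/measurable_EFinP/measurable_funX; exact: L2_measurable. Qed.

Lemma gauss_sqnorm_represents g v : represents g v ->
  gauss_sqnorm g = (plane_form v v)%:E.
Proof.
move=> gv; rewrite /plane_form /pair_form /L2form EFinD !ip_sqr /gauss_sqnorm.
rewrite -ge0_integralD//; first last.
- exact: measurable_L2sqr.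
- by move=> p _; rewrite lee_fin sqr_ge0.
- exact: measurable_L2sqr.
- by move=> p _; rewrite lee_fin sqr_ge0.
by apply: eq_integral => p _; rewrite (represents_density p gv) EFinD.
Qed.

Lemma measurable_wt : @measurable_fun _ _ plane R setT wt.
Proof. exact: continuous_measurable_plane (smC_continuous (smooth_wt 0%N)). Qed.

Lemma L2gauss_represents g : L2gauss g -> exists v, represents g v.
Proof.
move=> [[[m1 m2] _] goo].
have mwV : @measurable_fun _ _ plane R setT (fun p => expR (- half_sqnorm p)).
  apply: (@measurableT_comp _ _ _ _ _ _ (@expR R)) => //.
  apply: measurableT_comp => //.
  exact: continuous_measurable_plane (smC_continuous (smooth_half_sqnorm 0%N)).
have bound (c : R[i] -> R) : (forall z, c z ^+ 2 <= cabs z ^+ 2) ->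
    @measurable_fun _ _ plane R setT (fun p => c (g (cplx p))) ->
    exists f : L2plane, forall p, c (g (cplx p)) = wt p * f p.
  move=> cle mc.
  have [||f fE] := @L2_intro _ plane R sigma
    (fun p => c (g (cplx p)) * expR (- half_sqnorm p)).
  - exact: measurable_funM.
  - apply: le_lt_trans goo; apply: ge0_le_integral => //.
    + by move=> p _; rewrite lee_fin sqr_ge0.
    + by apply/measurable_EFinP/measurable_funX/measurable_funM.
    + apply/measurable_EFinP.
      rewrite (_ : (fun p => _) =
        (fun p => (complex.Re (g (cplx p)) * expR (- half_sqnorm p)) ^+ 2
        + (complex.Im (g (cplx p)) * expR (- half_sqnorm p)) ^+ 2)); last first.
        apply/funext => p; rewrite gauss_weight cabs_sqr expRN /wt /=; field.
        by rewrite gt_eqF// expR_gt0.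
      by apply: measurable_funD; apply/measurable_funX/measurable_funM.
    + move=> p _; rewrite lee_fin gauss_weight expRN exprMn exprVn.
      by rewrite ler_wpM2r// invr_ge0 sqr_ge0.
  by exists f => p; rewrite fE expRN mulrCA mulfV ?mulr1// gt_eqF// expR_gt0.
have [z|v1 e1] := bound (@complex.Re R) _ m1; first by rewrite cabs_sqr lerDl sqr_ge0.
have [z|v2 e2] := bound (@complex.Im R) _ m2; first by rewrite cabs_sqr lerDr sqr_ge0.
by exists (v1, v2) => p; rewrite /= -e1 -e2; case: (g _).
Qed.

(** On a compact set the weight is bounded, so the weighted norm controls the
    unweighted one. *)
Lemma represents_L2loc g v : represents g v -> L2loc g.
Proof.
move=> gv; split.
  have mwt (f : L2plane) : @measurable_fun _ _ plane R setT (fun p => wt p * f p).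
    by apply: measurable_funM; [exact: measurable_wt | exact: L2_measurable].
  split; [move: (mwt v.1)|move: (mwt v.2)];
    by congr (measurable_fun _ _); apply/funext => p; rewrite gv.
move=> K cK.
have mK : @measurable _ plane K.
  by apply: closed_measurable_plane; apply: compact_closed => //; exact: norm_hausdorff.
have cwt2 : continuous (wt \* wt : R * R -> R).
  exact: smC_continuous (smoothM smooth_wt smooth_wt 0%N).
have [N [_ HN]] := compact_bounded (continuous_compact (continuous_subspaceT cwt2) cK).
pose C := `|N| + 1.
have wtC p : K p -> wt p ^+ 2 <= C.
  move=> Kp; apply: le_trans (ler_norm _) _; apply: HN.
    by rewrite /C; have := ler_norm N; lra.
  by exists p => //=; rewrite expr2.
have C0 : 0 <= C by rewrite /C addr_ge0.
pose q p := v.1 p ^+ 2 + v.2 p ^+ 2.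
have mq : @measurable_fun _ _ plane R setT q.
  by apply: measurable_funD; apply: measurable_funX; exact: L2_measurable.
have q0 p : 0 <= q p by rewrite addr_ge0 ?sqr_ge0.
have qoo : (\int[sigma]_p (q p)%:E < +oo)%E.
  rewrite (_ : (\int[sigma]_p _)%E = gauss_sqnorm g).
    by rewrite (gauss_sqnorm_represents gv) ltry.
  by apply: eq_integral => p _; rewrite (represents_density p gv).
have gE p : cabs (g (cplx p)) ^+ 2 = wt p ^+ 2 * q p.
  by rewrite gv cabs_sqr /= !exprMn -mulrDr.
apply: (@le_lt_trans _ _ (\int[sigma]_(p in K) (C%:E * (q p)%:E))%E).
  apply: ge0_le_integral => //.
  - by move=> p _; rewrite lee_fin sqr_ge0.
  - apply/measurable_EFinP; apply: (@measurable_funS _ _ plane R setT) => //.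
    rewrite (_ : (fun p => _) = (fun p => wt p ^+ 2 * q p)); last by apply/funext.
    by apply: measurable_funM => //; apply: measurable_funX; exact: measurable_wt.
  - apply: (@measurable_funS _ _ plane _ setT) => //; apply/measurable_EFinP.
    exact: measurable_funM.
  - by move=> p Kp; rewrite -EFinM lee_fin gE ler_wpM2r// wtC.
rewrite ge0_integralZl_EFin//; first last.
- by apply: (@measurable_funS _ _ plane _ setT) => //; apply/measurable_EFinP.
- by move=> p _; rewrite lee_fin.
rewrite lte_mul_pinfty//; apply: le_lt_trans qoo.
by apply: ge0_subset_integral => // [|p _]; [exact/measurable_EFinP | rewrite lee_fin].
Qed.

End Representation.

(** * Existence of weak solutions *)

Section WeakSolutions.
Context {R : realType}.
Implicit Types (p : R * R) (z : R[i]) (g u phi : R[i] -> R[i]).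

Local Notation plane := (measurableTypeR R * measurableTypeR R)%type.
Local Notation sigma := (@lebesgue_measure R \x @lebesgue_measure R)%E.
Local Notation L2plane := (@L2 _ plane R sigma).
Local Notation W := (L2plane * L2plane)%type.
Local Notation V := (@testfun R * @testfun R)%type.

Definition has_components phi (P : V) := forall p, phi (cplx p) = P.1 p +i* P.2 p.

Definition tdbar : {linear V -> V} := cdbar (tpartial true) (tpartial false).

Lemma class_C_components n phi : class_C n phi ->
  smC n (fun p => complex.Re (phi (cplx p))) /\ smC n (fun p => complex.Im (phi (cplx p))).
Proof.
elim: n phi => [|n IH] phi //= [[cr ci] d hx hy].
have [rx ix] := IH _ hx; have [ry iy] := IH _ hy.
have dR i : has_partial i (fun p => complex.Re (phi (cplx p))).
  by move=> p; have [[dxr _] [dyr _]] := d (cplx p); case: i; [exact: dxr|exact: dyr].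
have dI i : has_partial i (fun p => complex.Im (phi (cplx p))).
  by move=> p; have [[_ dxi] [_ dyi]] := d (cplx p); case: i; [exact: dxi|exact: dyi].
split; split; [exact: cr|exact: dR| |exact: ci|exact: dI|].
  by case; [exact: rx|exact: ry].
by case; [exact: ix|exact: iy].
Qed.

Lemma test_function_components phi : test_function phi -> exists P, has_components phi P.
Proof.
move=> [sphi cphi].
have [N [_ HN]] := compact_bounded cphi.
have phi0 p : `|N| + 1 < `|p| -> phi (cplx p) = 0.
  move=> Np; apply/eqP; apply: contraTT Np => phip; rewrite -leNgt; apply: HN.
    by have := ler_norm N; lra.
  exact: subset_closure.
have sR : (fun p => complex.Re (phi (cplx p))) \in @compact_smooth R.
  apply/compact_smoothP; split; first by move=> n; have [] := class_C_components (sphi n).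
  by exists (`|N| + 1) => p /phi0 ->.
have sI : (fun p => complex.Im (phi (cplx p))) \in @compact_smooth R.
  apply/compact_smoothP; split; first by move=> n; have [] := class_C_components (sphi n).
  by exists (`|N| + 1) => p /phi0 ->.
by exists (TestFun sR, TestFun sI) => p /=; case: (phi _).
Qed.

Lemma half_complex : (2^-1 : R[i]) = (2^-1 : R)%:C.
Proof. by rewrite fmorphV rmorph_nat. Qed.

Lemma has_components_dbar phi P :
  has_components phi P -> has_components (dbar phi) (tdbar P).
Proof.
move=> hP p.
have eR : (fun q => complex.Re (phi (cplx q))) = P.1 by apply/funext => q; rewrite hP.
have eI : (fun q => complex.Im (phi (cplx q))) = P.2 by apply/funext => q; rewrite hP.
have ex : partial_x phi (cplx p) = partial true P.1 p +i* partial true P.2 p.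
  by rewrite -eR -eI.
have ey : partial_y phi (cplx p) = partial false P.1 p +i* partial false P.2 p.
  by rewrite -eR -eI.
rewrite /dbar ex ey half_complex.
apply/eqP; rewrite eq_complex /=; apply/andP; split; apply/eqP.
  rewrite -[RHS]/(2^-1 * (partial true P.1 p - partial false P.2 p)); ring.
rewrite -[RHS]/(2^-1 * (partial true P.2 p + partial false P.1 p)); ring.
Qed.

Lemma has_components_iter_dbar k phi P :
  has_components phi P -> has_components (iter k (@dbar R) phi) (iter k tdbar P).
Proof. by move=> hP; elim: k => //= k; exact: has_components_dbar. Qed.

Definition conj_weighted : {linear V -> W} := conj_lift (@weighted R).

Lemma conj_weighted_form P Q :
  plane_form (conj_weighted P) (conj_weighted Q) = pair_form testform P Q.
Proof. exact: (conj_lift_form (@weighted R) (L2form_semi_inner sigma)). Qed.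

Lemma plane_form_cmul a b (v : W) (P : V) :
  plane_form (cmul a b v) (conj_weighted P) = plane_form v (conj_weighted (cmul a b P)).
Proof. exact: (conj_lift_cmul (@weighted R) (L2form_semi_inner sigma)). Qed.

(** The imaginary part of [\int g phi] is the real part of [\int g (- i phi)], and
    [cmul 0 (-1)] is the multiplication by [- i]. *)
Lemma Cint_pairing g v phi P : represents g v -> has_components phi P ->
  Cint (fun z => g z * phi z)
  = plane_form v (conj_weighted P) +i* plane_form v (conj_weighted (cmul 0 (-1) P)).
Proof.
move=> gv hP.
have hI := L2form_semi_inner sigma.
have intE (v1 v2 : L2plane) (f1 f2 : testfun) (h : R * R -> R) :
    h =1 (fun p => wt p * v1 p * f1 p - wt p * v2 p * f2 p) ->
    Rintegral sigma setT h = plane_form (v1, v2) (conj_weighted (f1, f2)).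
  move=> hE; rewrite /plane_form /pair_form /= (siNr hI) /L2form /ip.
  rewrite -RintegralB//; [|exact: integrable_L2M..].
  by apply: eq_Rintegral => p _; rewrite hE !weightedE /=; ring.
rewrite /Cint; congr (_ +i* _).
  by rewrite (intE v.1 v.2 P.1 P.2) => [|p]; [case: (v); case: (P)|rewrite gv hP].
rewrite (intE v.1 v.2 (P.2) (- P.1)) => [|p].
  rewrite [v]surjective_pairing; congr (plane_form _ (conj_weighted _)).
  by rewrite /cmul !scale0r !scaleN1r sub0r opprK add0r.
by rewrite gv hP testfunNE /=; ring.
Qed.

Lemma tdbar_energy k a b P :
  (k.+1)`!%:R * pair_form testform P P
  <= pair_form testform (iter k.+1 tdbar P + cmul a b P) (iter k.+1 tdbar P + cmul a b P).
Proof.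
have hT := pair_semi_inner (@testform_semi_inner R).
pose E : {linear V -> V} := cdel (tadj true) (tadj false).
have adj Q1 Q2 : pair_form testform (tdbar Q1) Q2 = pair_form testform Q1 (E Q2).
  exact: (cdbar_adjoint (@testform_semi_inner R) (tpartial_adj true) (tpartial_adj false)).
have ccr Q : E (tdbar Q) = tdbar (E Q) + Q.
  exact: (cdbar_ccr (tpartial_ccr true) (tpartial_ccr false)
    (tpartial_comm true) (tpartial_comm false)).
exact: (ccr_perturbed_energy hT adj ccr k P (cmul_adjoint (@testform_semi_inner R) a b)
  (cmul_norm (@testform_semi_inner R) a b) (cdbar_cmul _ _ a (- b))).
Qed.

(** The functional to represent is [P |-> plane_form F (conj_weighted P)] on the
    range of [D^k + (a + i b)]; by Cauchy-Schwarz and [tdbar_energy] its squared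
    norm is at most [|F|^2 / k!], and this becomes the bound on the solution. *)
Lemma solve_dual k a b (F : W) : (0 < k)%N ->
  exists v : W, plane_form v v <= (k`!)%:R^-1 * plane_form F F /\
    forall P, plane_form v (conj_weighted (iter k tdbar P + cmul a b P))
      = plane_form F (conj_weighted P).
Proof.
case: k => // k _.
have hW := plane_form_semi_inner (R := R).
pose T P := conj_weighted (iter k.+1 tdbar P + cmul a b P).
have T_lin : linear T.
  have itlin j : linear (iter j tdbar).
    by elim: j => // j IH c P Q; rewrite !iterS IH linearP.
  move=> c P Q; rewrite /T -linearP; suff -> :
      iter k.+1 tdbar (c *: P + Q) + cmul a b (c *: P + Q) =
      c *: (iter k.+1 tdbar P + cmul a b P) + (iter k.+1 tdbar Q + cmul a b Q) by [].
  by rewrite itlin linearP scalerDr addrACA.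
pose TL : {linear V -> W} :=
  HB.pack T (GRing.isLinear.Build R V W _ T T_lin).
have fact_gt0R : 0 < (k.+1)`!%:R :> R by rewrite ltr0n fact_gt0.
apply: (riesz_range (T := TL) hW).
- exact: plane_form_complete.
- by rewrite mulr_ge0 ?invr_ge0 ?(si_ge0 hW)// ltW.
- by move=> P Q; rewrite linearD (siDr hW).
- by move=> c P; rewrite linearZ (siZr hW).
move=> P; apply: le_trans (si_CauchySchwarz hW _ _) _.
rewrite mulrAC [leRHS]mulrC ler_wpM2l ?(si_ge0 hW)//.
rewrite !conj_weighted_form mulrC ler_pdivlMr// mulrC.
exact: tdbar_energy.
Qed.

Lemma represents_sub_scale f u a b F v : represents f F -> represents u v ->
  represents (fun z => f z - (a +i* b) * u z) (F - cmul a b v).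
Proof.
move=> fF uv p; rewrite fF uv.
apply/eqP; rewrite eq_complex /=; apply/andP; split; apply/eqP.
  rewrite -[X in _ = wt p * X]/(F.1 p - (a * v.1 p - b * v.2 p)); ring.
rewrite -[X in _ = wt p * X]/(F.2 p - (a * v.2 p + b * v.1 p)); ring.
Qed.

End WeakSolutions.

Theorem theorem1p1 (R : realType) (k : nat) (k_gt0 : (0 < k)%N) (a : R[i])
    (f : R[i] -> R[i]) (fL2 : L2gauss f) :
  exists u : R[i] -> R[i],
    [/\ L2gauss u,
        weak_solution k a f u &
        (gauss_sqnorm u <= ((k`!)%:R^-1)%:E * gauss_sqnorm f)%E].
Proof.
have [F fF] := L2gauss_represents fL2; case: a => a1 a2.
have hW := plane_form_semi_inner (R := R).
pose s : R := (-1) ^+ k.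
have s_sqr : s * s = 1 by rewrite /s -expr2 sqrr_sign.
(* the sign [s] comes from the k integrations by parts of the weak formulation *)
have [v [v_le v_eq]] := solve_dual (s * a1) (s * a2) (s *: F) k_gt0.
have [u uv] := represents_exists v.
have gv := represents_sub_scale a1 a2 fF uv.
have uL2 := represents_L2loc uv.
exists u; split.
- by split=> //; rewrite (gauss_sqnorm_represents uv) ltry.
- split=> //; first exact: represents_L2loc gv.
  move=> phi /test_function_components[P hP].
  rewrite (Cint_pairing uv (has_components_iter_dbar k hP)) (Cint_pairing gv hP).
  have key Q : plane_form v (conj_weighted (iter k tdbar Q))
      = s * plane_form (F - cmul a1 a2 v) (conj_weighted Q).
    have := v_eq Q; rewrite linearD (siDr hW) (siZl hW).
    rewrite (siBl hW) plane_form_cmul.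
    have -> : cmul (s * a1) (s * a2) Q = s *: cmul a1 a2 Q.
      by rewrite /cmul -!scalerA -scalerBr -scalerDr.
    by rewrite linearZ (siZr hW) => E; rewrite mulrBr -E; ring.
  (* [key] at P gives the real part, at - i P the imaginary part *)
  have commJ : cmul 0 (-1) (iter k tdbar P) = iter k tdbar (cmul 0 (-1) P).
    by elim: (k) => //= j IH; rewrite -IH cdbar_cmul.
  rewrite commJ !key.
  have -> : (-1) ^+ k = s%:C by rewrite /s rmorphXn /= rmorphN rmorph1.
  by apply/eqP; rewrite eq_complex /=; apply/andP; split; apply/eqP; ring.
- rewrite (gauss_sqnorm_represents uv) (gauss_sqnorm_represents fF) -EFinM lee_fin.
  by move: v_le; rewrite (siZl hW) (siZr hW) mulrA s_sqr mul1r.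
Qed.
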